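(* Let $\mathbb J$ be a compact subset of $\mathbb J_\ast:=\{(t,s)\in\mathbb R^2:0<s<t\}$ and let $$\mathcal M_cf(x)=\sup_{(t,s)\in\mathbb J}\big|\mathcal A_t^sf(x)\big|,\qquad x\in\mathbb R^3.$$ Let $\mathcal Q$ be the open quadrangle with vertices $(0,0)$, $(1/2,1/2)$, $P_1=(5/11,2/11)$ and $P_2=(3/7,1/7)$ which includes the half open line segment $[(0,0),(1/2,1/2))$, and let $\overline{\mathcal Q}$ be its closure, i.e. the closed quadrangle with these vertices. Let $1\le p,q\le\infty$. If $(1/p,1/q)\notin\overline{\mathcal Q}\setminus\{(1/2,1/2)\}$, then the estimate $$\|\mathcal M_cf\|_{L^q(\mathbb R^3)}\le C\|f\|_{L^p(\mathbb R^3)}$$ fails, i.e. there is no constant $C$ for which it holds for all $f$.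
   Context: For $0<s<t$ set $\Phi_t^s(\theta,\phi)=\big((t+s\cos\theta)\cos\phi,\,(t+s\cos\theta)\sin\phi,\,s\sin\theta\big)$, a parametrization of the torus $\mathbb T_t^s=\{\Phi_t^s(\theta,\phi):\theta,\phi\in[0,2\pi)\}\subset\mathbb R^3$. The measure $\sigma_t^s$ on $\mathbb T_t^s$ is defined by $\langle f,\sigma_t^s\rangle=\int_{[0,2\pi)^2}f(\Phi_t^s(\theta,\phi))\,d\theta\,d\phi$, and $\mathcal A_t^sf=f*\sigma_t^s$, i.e. $\mathcal A_t^sf(x)=\int_{[0,2\pi)^2}f(x-\Phi_t^s(\theta,\phi))\,d\theta\,d\phi$.
   Formalization: The compact set J is additionally assumed to have nonempty interior; without such an assumption the claim is false (for J a single point the operator is convolution with a finite measure, bounded on L^1, although (1,1) lies outside the quadrangle). *)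

(* Defs.v *)
From HB Require Import structures.
From mathcomp Require Import all_boot all_order all_algebra.
From mathcomp Require Import all_classical all_reals all_analysis.

Set Implicit Arguments.
Unset Strict Implicit.
Unset Printing Implicit Defensive.

Import Order.TTheory GRing.Theory Num.Theory.
Import numFieldNormedType.Exports.

Local Open Scope classical_set_scope.
Local Open Scope ring_scope.

(* [measurableTypeR R] is R with its Borel sigma-algebra, so these are R^2 and
   R^3 with their Borel sets; addition and subtraction are componentwise. *)
Notation borelR2 R := (measurableTypeR R * measurableTypeR R)%type.
Notation borelR3 R :=
  (measurableTypeR R * measurableTypeR R * measurableTypeR R)%type.

Section torus_maximal.
Context {R : realType}.

Definition leb2 : {measure set (borelR2 R) -> \bar R} :=
  (@lebesgue_measure R \x @lebesgue_measure R)%E.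

Definition leb3 : {measure set (borelR3 R) -> \bar R} :=
  ((@lebesgue_measure R \x @lebesgue_measure R) \x @lebesgue_measure R)%E.

Definition admissible : set (R * R) := [set ts | 0 < ts.2 < ts.1].

Definition torus_param (ts : R * R) (z : borelR2 R) : borelR3 R :=
  ((ts.1 + ts.2 * cos z.1) * cos z.2,
   (ts.1 + ts.2 * cos z.1) * sin z.2,
   ts.2 * sin z.1).

Definition angles : set (borelR2 R) := `[0, 2 * pi[ `*` `[0, 2 * pi[.

(* The integral is extended-real valued.  When both the positive and the
   negative part have integral +oo it is -oo, so that its absolute value in
   torus_maximal is +oo, as for the average of `|f|. *)
Definition torus_average (ts : R * R) (f : borelR3 R -> R) (x : borelR3 R)
    : \bar R :=
  (\int[leb2]_(z in angles) (f (x - torus_param ts z))%:E)%E.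

Definition torus_maximal (J : set (R * R)) (f : borelR3 R -> R) (x : borelR3 R)
    : \bar R :=
  ereal_sup [set `|torus_average ts f x|%E | ts in J].

Definition quadrangle_vertex (i : 'I_4) : R * R :=
  [:: (0, 0); (1/2, 1/2); (5/11, 2/11); (3/7, 1/7)]`_i.

(* The vertices, in cyclic order, are in convex position, so the closed
   quadrangle with these vertices is their convex hull. *)
Definition closed_quadrangle : set (R * R) :=
  [set v | exists w : 'I_4 -> R,
     [/\ forall i, 0 <= w i, \sum_(i < 4) w i = 1 &
         v = \sum_(i < 4) w i *: quadrangle_vertex i]].

(* f ranges over the Borel functions with finite L^p norm. The maximal function
   is Lebesgue measurable but possibly not Borel; its norm is then the lower
   integral (or, for q = +oo, the essential supremum up to null sets), which is
   its usual L^q norm. *)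
Definition torus_maximal_estimate (J : set (R * R)) (p q : \bar R) : Prop :=
  exists C : R, forall f : borelR3 R -> R, f \in Lfun leb3 p ->
    ('N[leb3]_q[torus_maximal J f] <= C%:E * 'N[leb3]_p[EFin \o f])%E.

End torus_maximal.

(* Main.v *)
(* Write u = 1/p and v = 1/q.  If M_c 1_A >= delta on E, the estimate gives
   delta |E|^v <= C |A|^u; when |A|, |E| and delta are powers of e with
   exponents gamma, alpha and beta, letting e -> 0 forces
   gamma u <= beta + alpha v.  Four test families give the four sides of the
   quadrangle:
   - v <= u: A and E are boxes of size 1/e;
   - u <= 3v: E is an e-ball and A an e-neighbourhood of a torus;
   - 3u - 2v <= 1: A is an e x e x e^2 neighbourhood of a horizontal circle, E a
     vertical e-tube; s = x_3 puts x on a horizontal circle of tangency of the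
     torus x - T_t^s, near which theta ranges over an interval of length e;
   - 7u - v <= 3: t = x_1 and s = x_3 make x - T_t^s tangent at 0 to the
     plane x_3 = 0; A is an e^2 x e x e^4 box around 0.
   At p = q = 2 the last example is superposed at the scales e = 2^-j, j < n,
   with weights making each scale contribute equally: the averages are of size
   n, but the L^2 norm of the function is only of size n^(1/2). *)
Require Import Defs.
From mathcomp Require Import all_boot all_order all_algebra.
From mathcomp Require Import all_classical all_reals all_analysis.
From mathcomp Require Import measurable_realfun ess_sup_inf ring lra.

Import Order.TTheory GRing.Theory Num.Theory.
Import numFieldNormedType.Exports.

Local Open Scope classical_set_scope.
Local Open Scope ring_scope.

Set Implicit Arguments.
Unset Strict Implicit.
Unset Printing Implicit Defensive.

(** * Norm bounds through indicators, and measures of finite unions *)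

Section lower_integral.
Context d (T : measurableType d) (R : realType).
Variable mu : {measure set T -> \bar R}.

(* The integral of a nonnegative function is a lower integral, so monotonicity
   needs no measurability. *)
Lemma le_lower_integral (D : set T) (f g : T -> \bar R) :
  (forall x, D x -> 0 <= f x)%E -> (forall x, D x -> f x <= g x)%E ->
  (\int[mu]_(x in D) f x <= \int[mu]_(x in D) g x)%E.
Proof.
move=> f0 fg.
have g0 x : D x -> (0 <= g x)%E.
  by move=> Dx; exact: le_trans (f0 _ Dx) (fg _ Dx).
rewrite !ge0_integralE//; apply: le_ereal_sup => _ [h /= hf <-]; exists h => //.
move=> x; apply: (le_trans (hf x)); rewrite /patch.
by case: ifPn => // /set_mem; exact: fg.
Qed.

(** Chebyshev's inequality, with [f] possibly non-measurable: [|f| ^ q] dominates [c ^ q] times the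
    indicator of [E]. For [q = +oo] the exponent is 0, and [0 < m] keeps [E] from being null. *)
Lemma Lnorm_ge_cst (q : \bar R) (f : T -> \bar R) (E : set T) (c m : R) :
  (1 <= q)%E -> measurable E -> (m%:E <= mu E)%E -> 0 < m -> 0 <= c ->
  (forall x, E x -> c%:E <= `|f x|)%E ->
  ((c * m `^ fine q^-1)%:E <= 'N[mu]_q[f])%E.
Proof.
move=> q1 mE mEm m0 c0 cf; rewrite unlock; case: q q1 => [r||]//=.
- rewrite lee_fin => r1; have r0 : 0 < r by exact: lt_le_trans r1.
  rewrite (inver r) gt_eqF//=.
  have -> : ((c * m `^ r^-1)%:E = ((c `^ r * m)%:E `^ r^-1))%E.
    by rewrite poweR_EFin powRM ?powR_ge0 ?ltW// -powRrM divff ?gt_eqF// powRr1.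
  apply: gt0_ler_poweR; first by rewrite invr_ge0 ltW.
  - by rewrite in_itv/= leey andbT lee_fin mulr_ge0 ?powR_ge0 ?ltW.
  - by rewrite in_itv/= leey andbT integral_ge0 // => x _; exact: poweR_ge0.
  apply: (@le_trans _ _ (\int[mu]_x ((c `^ r)%:E * (\1_E x)%:E)))%E.
    rewrite ge0_integralZl//.
    + by rewrite integral_indic// setIT EFinM lee_wpmul2l ?lee_fin ?powR_ge0.
    + by apply/measurable_EFinP.
    + by rewrite lee_fin powR_ge0.
  apply: le_lower_integral => x _.
    by rewrite mule_ge0 ?lee_fin ?powR_ge0.
  rewrite indicE; case: (boolP (x \in E)) => [/set_mem Ex|_].
    rewrite mule1 -poweR_EFin gt0_ler_poweR ?(ltW r0)//.
    + by rewrite in_itv/= leey andbT lee_fin c0.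
    + by rewrite in_itv/= leey andbT abse_ge0.
    + exact: cf.
  by rewrite mule0 poweR_ge0.
- move=> _; rewrite powRr0 mulr1.
  have muE : (0 < mu E)%E by apply: lt_le_trans mEm; rewrite lte_fin.
  have -> : (0 < mu setT)%E.
    by apply: (lt_le_trans muE); apply: le_measure; rewrite ?inE.
  (* If the essential supremum were below [c], then [E] would lie in a null set. *)
  rewrite leNgt; apply/negP => fc.
  suff : mu E = 0%E by move=> E0; rewrite E0 ltxx in muE.
  have := ess_sup_ge mu (abse \o f) => -[N [mN N0 sN]].
  apply: (subset_measure0 mE mN) N0 => x Ex; apply: sN => /= h.
  by have := le_lt_trans (le_trans (cf x Ex) h) fc; rewrite ltxx.
Qed.

Lemma Lnorm_indic_le (p : \bar R) (A : set T) (m : R) :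
  (1 <= p)%E -> measurable A -> (mu A <= m%:E)%E ->
  ('N[mu]_p[EFin \o \1_A] <= (m `^ fine p^-1)%:E)%E.
Proof.
move=> p1 mA mAm.
have m0 : 0 <= m by rewrite -lee_fin (le_trans _ mAm).
rewrite unlock; case: p p1 => [r||]//=.
- rewrite lee_fin => r1; have r0 : 0 < r by exact: lt_le_trans r1.
  rewrite (inver r) gt_eqF//= -poweR_EFin.
  rewrite [X in (X `^ _)%E](_ : _ = mu A).
    apply: gt0_ler_poweR => //; first by rewrite invr_ge0 ltW.
      by rewrite in_itv/= leey andbT measure_ge0.
    by rewrite in_itv/= leey andbT lee_fin m0.
  rewrite -[A in RHS]setIT -integral_indic//; apply: eq_integral => x _.
  rewrite indicE; case: (x \in A); first by rewrite /= normr1 powR1.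
  by rewrite /= normr0 powR0 ?gt_eqF.
- move=> _; rewrite powRr0; case: ifPn => // _.
  apply/ess_supP; apply: nearW => x /=.
  by rewrite lee_fin indicE; case: (x \in A); rewrite ?normr1 ?normr0.
Qed.

Lemma measure_bigsetU_le (I : Type) (s : seq I) (A : I -> set T) (m : R) :
  (forall i, measurable (A i)) -> (forall i, mu (A i) <= m%:E)%E ->
  (mu (\big[setU/set0]_(i <- s) A i) <= ((size s)%:R * m)%:E)%E.
Proof.
move=> mA Am; elim: s => [|i s IH]; first by rewrite big_nil measure0 mul0r.
rewrite big_cons (le_trans (measureU2 _ _ _))//.
  exact: bigsetU_measurable.
by rewrite /= -addn1 natrD mulrDl mul1r addrC EFinD leeD.
Qed.

(** The square root makes the L^2 norm depend on [g] only through its integral, so superposing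
    functions inside the root produces no cross terms. *)
Lemma Lnorm2_sqrt (g : T -> R) : (forall x, 0 <= g x) ->
  ('N[mu]_2%:E[EFin \o (Num.sqrt \o g)] = (\int[mu]_x (g x)%:E) `^ 2^-1)%E.
Proof.
move=> g0; rewrite unlock; congr (_ `^ _)%E; apply: eq_integral => x _ /=.
by rewrite (ger0_norm (sqrtr_ge0 _)) powR_mulrn ?sqrtr_ge0// sqr_sqrtr.
Qed.

End lower_integral.

(** * Boxes in R^3 and rectangles of angles, with their measures *)

Section boxes.
Context {R : realType}.
Implicit Types (a b r : R) (c : borelR3 R).

Definition box (c : borelR3 R) (r1 r2 r3 : R) : set (borelR3 R) :=
  (`[c.1.1 - r1, c.1.1 + r1] `*` `[c.1.2 - r2, c.1.2 + r2]) `*`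
  `[c.2 - r3, c.2 + r3].

Definition rect (a b a' b' : R) : set (borelR2 R) := `[a, b] `*` `[a', b'].

Lemma boxP c r1 r2 r3 x : box c r1 r2 r3 x <->
  [/\ `|x.1.1 - c.1.1| <= r1, `|x.1.2 - c.1.2| <= r2 & `|x.2 - c.2| <= r3].
Proof.
rewrite /box /= !in_itv/= -!ler_distl.
by split=> [[[]]//|[]].
Qed.

Lemma measurable_box c r1 r2 r3 : measurable (box c r1 r2 r3).
Proof. by apply: measurableX => //; apply: measurableX. Qed.

Lemma lebesgue_measure_itvcc a b : a <= b ->
  lebesgue_measure (`[a, b] : set R) = (b - a)%:E.
Proof.
move=> ab; rewrite lebesgue_measure_itv/= lte_fin EFinB.
by move: ab; rewrite le_eqVlt => /predU1P[->|->//]; rewrite ltxx subee.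
Qed.

Lemma leb3_box c r1 r2 r3 : 0 <= r1 -> 0 <= r2 -> 0 <= r3 ->
  leb3 (box c r1 r2 r3) = (8 * (r1 * r2 * r3))%:E.
Proof.
move=> r10 r20 r30; rewrite [LHS]product_measure1E//; last exact: measurableX.
rewrite [X in (X * _)%E]product_measure1E//.
have E (y r : R) : 0 <= r ->
    lebesgue_measure (`[y - r, y + r] : set R) = (2 * r)%:E.
  by move=> r0; rewrite lebesgue_measure_itvcc ?lerBlDr; [congr EFin; ring|lra].
transitivity ((2 * r1)%:E * (2 * r2)%:E * (2 * r3)%:E)%E.
  by congr (_ * _ * _)%E; exact: E.
by rewrite -!EFinM; congr EFin; ring.
Qed.

Lemma measurable_rect a b a' b' : measurable (rect a b a' b').
Proof. exact: measurableX. Qed.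

Lemma leb2_rect a b a' b' : a <= b -> a' <= b' ->
  leb2 (rect a b a' b') = ((b - a) * (b' - a'))%:E.
Proof.
move=> ab ab'; rewrite [LHS]product_measure1E// EFinM.
by congr (_ * _)%E; exact: lebesgue_measure_itvcc.
Qed.

Lemma measurable_angles : measurable (@angles R).
Proof. exact: measurableX. Qed.

Lemma rect_sub_angles a b a' b' :
  0 <= a -> b <= pi / 2 + 1 -> 0 <= a' -> b' <= 1 -> rect a b a' b' `<=` @angles R.
Proof.
move=> a0 b1 a'0 b'1 [z1 z2] /=; rewrite /rect /angles /= !in_itv/=.
move=> [/andP[az zb] /andP[cz zd]]; have := pi_ge2 R.
by split; apply/andP; split; lra.
Qed.

End boxes.

(** * Lower bounds for the averages, and the estimate tested on indicators *)

Section maximal_lower_bounds.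
Context {R : realType}.
Implicit Types (J : set (R * R)) (f : borelR3 R -> R).

(** Disjointness of the [D i] keeps the sum of [c i] times their indicators below the integrand. One
    set serves for indicators; several are needed for the superposed scales. *)
Lemma torus_average_ge (ts : R * R) f (x : borelR3 R) n
    (D : nat -> set (borelR2 R)) (c : nat -> R) :
  (forall y, 0 <= f y) -> (forall i, 0 <= c i) ->
  (forall i, measurable (D i)) -> (forall i, D i `<=` angles) ->
  trivIset setT D ->
  (forall i z, D i z -> c i <= f (x - torus_param ts z)) ->
  (\sum_(i < n) ((c i)%:E * leb2 (D i)) <= torus_average ts f x)%E.
Proof.
move=> f0 c0 mD Dsub tD cf; rewrite /torus_average.
rewrite (_ : (\sum_(i < n) _)%E =
    (\int[leb2]_(z in angles) \sum_(i < n) ((c i)%:E * (\1_(D i) z)%:E))%E).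
  apply: le_lower_integral => z _.
    by apply: sume_ge0 => i _; rewrite mule_ge0 ?lee_fin.
  have [[i0 [i0n Di0]]|nD] := pselect (exists i, (i < n)%N /\ D i z).
    rewrite (bigD1 (Ordinal i0n))//= big1 ?adde0.
      by rewrite indicE mem_set// mule1 lee_fin cf.
    move=> i ii0; rewrite indicE memNset ?mule0// => Di.
    move/negP: ii0; apply; apply/eqP/val_inj => /=.
    by apply: tD => //; exists z.
  rewrite big1 ?lee_fin ?f0// => i _; rewrite indicE memNset ?mule0// => Di.
  by apply: nD; exists i.
rewrite ge0_integral_sum//.
- apply: eq_bigr => i _; rewrite ge0_integralZl//.
  + by rewrite integral_indic ?(setIidl (Dsub i))//; exact: measurable_angles.
  + exact: measurable_angles.
  + by apply/measurable_EFinP.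
  + by rewrite lee_fin.
- exact: measurable_angles.
- by move=> i; apply: measurable_funeM; apply/measurable_EFinP.
- by move=> i z _; rewrite mule_ge0 ?lee_fin.
Qed.

Lemma torus_maximal_ge J ts f x (c : R) : J ts ->
  (c%:E <= torus_average ts f x)%E -> (c%:E <= `|torus_maximal J f x|)%E.
Proof.
move=> Jts cf; apply: (le_trans cf); apply: (le_trans (lee_abs _)).
apply: le_trans (lee_abs _); rewrite /torus_maximal.
by apply: ereal_sup_ubound; exists ts.
Qed.

(* On [E] the averages of the indicator of [A] are at least [delta]: [D] is a
   set of angles parametrizing a part of the translated torus inside [A]. *)
Definition test_sets J (a e delta : R) : Prop :=
  exists A E : set (borelR3 R),
    [/\ measurable A, measurable E, (leb3 A <= a%:E)%E, (e%:E <= leb3 E)%E &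
      forall x, E x -> exists2 ts, J ts & exists D : set (borelR2 R),
        [/\ measurable D, D `<=` angles, (delta%:E <= leb2 D)%E &
            forall z, D z -> A (x - torus_param ts z)]].

Lemma indicator_estimate J p q : (1 <= p)%E -> (1 <= q)%E ->
  torus_maximal_estimate J p q ->
  exists C : R, forall a e delta : R, 0 < e -> 0 <= delta ->
    test_sets J a e delta ->
    delta * e `^ fine q^-1%E <= C * a `^ fine p^-1%E.
Proof.
move=> p1 q1 [C HC]; exists (Num.max C 0) => a e delta e0 delta0.
move=> [A [E [mA mE Aa eE HE]]].
have lA := Lnorm_indic_le p1 mA Aa.
have : \1_A \in Lfun leb3 p.
  rewrite inE/=; apply/andP; split; rewrite inE/=.
    exact: measurable_indic.
  by rewrite /finite_norm (le_lt_trans lA)// ltry.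
move=> /HC; rewrite -lee_fin => H.
apply: le_trans (le_trans H _).
  apply: (Lnorm_ge_cst q1 mE eE) => // x /HE [ts Jts [D [mD Dsub dD DA]]].
  apply: (torus_maximal_ge Jts).
  (* A single set of angles, padded with empty sets to a sequence. *)
  pose Dn i := if i == 0%N then D else set0.
  have := @torus_average_ge ts \1_A x 1 Dn (fun=> 1).
  rewrite big_ord1/= mul1e => h; apply: (le_trans dD); apply: h => //.
  - by move=> i; rewrite /Dn; case: ifP.
  - by move=> i; rewrite /Dn; case: ifP.
  - apply/trivIsetP => i j _ _; rewrite /Dn.
    case: ifP => [/eqP->|_]; case: ifP => [/eqP->|_];
      by rewrite ?set0I ?setI0 ?eqxx.
  - move=> i z; rewrite /Dn; case: ifP => // _ Dz.
    by rewrite indicE mem_set//; exact: DA.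
apply: (@le_trans _ _ ((Num.max C 0)%:E * 'N[leb3]_p[EFin \o \1_A])%E).
  by apply: lee_wpmul2r; [exact: Lnorm_ge0|rewrite lee_fin le_max lexx].
by rewrite EFinM; apply: lee_wpmul2l => //; rewrite lee_fin le_max lexx orbT.
Qed.

End maximal_lower_bounds.

(** * From test families to inequalities between exponents *)

Section scaling.
Context {R : realType}.
Implicit Types (J : set (R * R)).

Lemma powR_unbounded (x M : R) : 0 < x ->
  ~ (forall n : nat, n.+1%:R `^ x <= M).
Proof.
move=> x0 H; have M0 : 0 <= M by rewrite (le_trans _ (H 0%N))// powR_ge0.
(* For this [n], [n.+1] exceeds [M ^ (1/x)]. *)
have := H (Num.truncn (M `^ x^-1)); apply/negP; rewrite -ltNge.
have ME : M = (M `^ x^-1) `^ x by rewrite -powRrM mulVf ?gt_eqF// powRr1.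
rewrite [ltLHS]ME.
by apply: gt0_ltr_powR; rewrite ?nnegrE ?powR_ge0 ?truncnS_gt.
Qed.

(** Tested at scale [e], the estimate bounds [(1/e) ^ (gamma u - beta - alpha v)] by a constant
    independent of [n]. Since [1/e = n.+1] is unbounded, that exponent cannot be positive. *)
Lemma test_sets_exponents J p q (alpha beta gamma K k : R) :
  (1 <= p)%E -> (1 <= q)%E -> torus_maximal_estimate J p q ->
  0 < K -> 0 < k ->
  (forall n, let e := n.+1%:R^-1 : R in
    test_sets J (K * e `^ gamma) (k * e `^ alpha) (k * e `^ beta)) ->
  gamma * fine p^-1%E <= beta + alpha * fine q^-1%E.
Proof.
move=> p1 q1 /(indicator_estimate p1 q1)[C HC] K0 k0 Htest.
set u := fine p^-1%E; set v := fine q^-1%E.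
rewrite leNgt; apply/negP => h.
have d0 : 0 < gamma * u - (beta + alpha * v) by rewrite subr_gt0.
apply: (@powR_unbounded _ (C * K `^ u / (k * k `^ v)) d0) => n.
have e0 : 0 < n.+1%:R^-1 :> R by rewrite invr_gt0.
have -> : n.+1%:R = (n.+1%:R^-1)^-1 :> R by rewrite invrK.
move: (Htest n) => /=; move: (n.+1%:R^-1) e0 => e e0 T.
have ke0 x : 0 < k * e `^ x by rewrite mulr_gt0 ?powR_gt0.
have := HC _ _ _ (ke0 _) (ltW (ke0 _)) T.
rewrite -/u -/v !powRM ?powR_ge0 ?(ltW K0) ?(ltW k0)// -!powRrM.
have kv0 : 0 < k * k `^ v by rewrite mulr_gt0// powR_gt0.
rewrite ler_pdivlMr// -powR_inv1 ?(ltW e0)// -powRrM mulN1r opprB.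
have en0 : e != 0 by rewrite gt_eqF.
rewrite powRB ?en0 ?implybT// powRD ?en0 ?implybT//.
have : 0 < e `^ (gamma * u) by exact: powR_gt0.
move: (e `^ (gamma * u)) => G G0 H.
rewrite -(ler_pM2r G0); apply: le_trans (le_trans H _); last by rewrite mulrA.
rewrite le_eqVlt; apply/orP; left; apply/eqP; field.
by rewrite gt_eqF.
Qed.

End scaling.

(** * Trigonometric bounds and grid points *)

Section elementary_bounds.
Context {R : realType}.
Implicit Types x y : R.

Lemma norm_mvt_le (f f' : R -> R) x y :
  (forall z : R, is_derive z (1 : R) f (f' z)) -> (forall z, `|f' z| <= 1) ->
  `|f x - f y| <= `|x - y|.
Proof.
move=> df f'1.
wlog xy : x y / y <= x.
  by move=> H; case: (leP y x) => [/H//|/ltW/H]; rewrite distrC (distrC y).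
have [->|yx] := eqVneq y x; first by rewrite !subrr.
have {}xy : y < x by rewrite lt_neqAle yx.
have cf : continuous f.
  by move=> z; apply: differentiable_continuous; apply/derivable1_diffP.
have [z _ ->] := MVT xy (fun z _ => df z) (continuous_subspaceT cf).
by rewrite normrM ler_piMl.
Qed.

Lemma sin_lipschitz x y : `|sin x - sin y| <= `|x - y|.
Proof. by apply: (@norm_mvt_le sin cos) => z; exact: cos_max. Qed.

Lemma cos_lipschitz x y : `|cos x - cos y| <= `|x - y|.
Proof.
by apply: (@norm_mvt_le cos (fun z => - sin z)) => z; rewrite normrN sin_max.
Qed.

Lemma norm_sin_le x : `|sin x| <= `|x|.
Proof. by have := sin_lipschitz x 0; rewrite sin0 !subr0. Qed.

Lemma one_sub_cos_le x : `|1 - cos x| <= x ^+ 2.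
Proof.
have -> : 1 - cos x = 2 * sin (x / 2) ^+ 2.
  by rewrite [in cos x](splitr x) cosD -!expr2 cos2sin2; ring.
rewrite ger0_norm; last exact: mulr_ge0 (ler0n _ 2) (sqr_ge0 _).
have : sin (x / 2) ^+ 2 <= (x / 2) ^+ 2.
  rewrite -[leLHS]real_normK ?num_real// -[leRHS]real_normK ?num_real//.
  by rewrite lerXn2r ?nnegrE// norm_sin_le.
have := sqr_ge0 x; lra.
Qed.

Lemma norm_mul_le (a b A B : R) : `|a| <= A -> `|b| <= B -> `|a * b| <= A * B.
Proof. by move=> aA bB; rewrite normrM ler_pM. Qed.

Lemma norm_mul_cos_le (a y : R) : `|a * cos y| <= `|a|.
Proof. by rewrite normrM ler_piMr ?cos_max. Qed.

Lemma norm_mul_sin_le (a y : R) : `|a * sin y| <= `|a|.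
Proof. by rewrite normrM ler_piMr ?sin_max. Qed.

(** Round [y] down to the grid 0, e, ..., (n + 1) e = 1, which has n + 2 points; the last one is
    needed for [y = 1]. *)
Lemma grid_point n (y : R) : 0 <= y <= 1 -> let e := n.+1%:R^-1 : R in
  exists2 i : nat, (i < n.+2)%N & `|y - i%:R * e| <= e.
Proof.
move=> /andP[y0 y1] e; have N0 : 0 < n.+1%:R :> R by [].
have yN0 : 0 <= y * n.+1%:R by rewrite mulr_ge0.
exists (Num.truncn (y * n.+1%:R)).
  rewrite truncn_lt_nat// (le_lt_trans (_ : _ <= n.+1%:R)) ?ltr_nat//.
  by rewrite ler_piMl.
have /andP[] := truncn_itv yN0.
move: (Num.truncn _) => i h1 h2.
have e0 : 0 < e by rewrite invr_gt0.
have -> : y = (y * n.+1%:R) * e by rewrite -mulrA divff ?mulr1// gt_eqF.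
rewrite -mulrBl normrM (gtr0_norm e0) ler_piMl ?(ltW e0)//.
by rewrite ler_norml; move: h2; rewrite -[ltRHS]natr1; lra.
Qed.

(** At the top circle of the torus, theta = pi/2, the distance to the axis varies to first order in
    theta but the height only to second order. This is why test boxes can be so thin vertically. *)
Lemma polar_angle_bounds (y d : R) : pi / 2 <= y <= pi / 2 + d ->
  `|cos y| <= d /\ `|1 - sin y| <= d ^+ 2.
Proof.
move=> /andP[y0 yd]; have -> : y = (y - pi / 2) + pi / 2 by rewrite subrK.
have yd' : `|y - pi / 2| <= d by rewrite ger0_norm; lra.
have d0 : 0 <= d by lra.
rewrite cosDpihalf sinDpihalf normrN; split.
  exact: le_trans (norm_sin_le _) yd'.
apply: (le_trans (one_sub_cos_le _)).
by rewrite -[leLHS]real_normK ?num_real// lerXn2r// nnegrE.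
Qed.

End elementary_bounds.

(** * Four families of test sets, one for each side of the quadrangle *)

Section test_families.
Context {R : realType}.
Variables (J : set (R * R)) (t0 s0 r : R).
Hypotheses (r0 : 0 < r) (r1 : r <= 1).
Hypothesis Jball : forall t s, `|t - t0| <= r -> `|s - s0| <= r ->
  0 < s < t /\ J (t, s).

(** [L] bounds [t + s] for all parameters within [r] of [(t0, s0)]; [K] is large enough to absorb
    all the errors below. *)
Let L := t0 + s0 + 2 * r.
Let K := 1 + 2 * L.

Lemma radius_le t s y : `|t - t0| <= r -> `|s - s0| <= r ->
  `|t + s * cos y| <= t + s.
Proof.
move=> tr sr; have [/andP[s_gt0 st] _] := Jball tr sr.
apply: (le_trans (ler_normD _ _)); apply: lerD.
  by rewrite gtr0_norm ?(lt_trans s_gt0 st).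
by rewrite (le_trans (norm_mul_cos_le _ _))// gtr0_norm.
Qed.

Lemma ball_bounds t s : `|t - t0| <= r -> `|s - s0| <= r ->
  [/\ 0 < s, 0 < t, t + s <= L & J (t, s)].
Proof.
move=> tr sr; have [/andP[s_gt0 st] Jts] := Jball tr sr.
split => //; first exact: lt_trans st.
by move: tr sr; rewrite !ler_norml /L => /andP[_ ?] /andP[_ ?]; lra.
Qed.

Let t0r : `|t0 - t0| <= r. Proof. by rewrite subrr normr0 ltW. Qed.
Let s0r : `|s0 - s0| <= r. Proof. by rewrite subrr normr0 ltW. Qed.

Let L0 : 0 < L.
Proof. by have [? ? ? _] := ball_bounds t0r s0r; lra. Qed.

Let K1 : 1 <= K. Proof. by rewrite /K; have := L0; lra. Qed.

(** The exponents (gamma, alpha, beta) = (-3, -3, 0) give v <= u. One torus suffices: a shift by at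
    most [L] stays in the box enlarged by the factor [K], since 1/e >= 1. *)
Lemma test_sets_big_boxes n : let e := n.+1%:R^-1 : R in
  test_sets J (8 * K ^+ 3 * e `^ (-3)) (1 * e `^ (-3)) (1 * e `^ 0).
Proof.
move=> e; have e0 : 0 < e by rewrite invr_gt0.
have e1 : 1 <= e^-1 by rewrite invrK ler1n.
have [s0_gt0 t0_gt0 tsL J0] := ball_bounds t0r s0r.
rewrite powRr0 powR_invn ?(ltW e0)// -exprVn.
move: e1; move: (e^-1) => d d1.
have KL : L <= K * d - d by have := ler_wpM2l (ltW L0) d1; rewrite /K; lra.
exists (box 0 (K * d) (K * d) (K * d)), (box 0 d d d).
have d0 : 0 <= d by lra.
have Kd : 0 <= K * d by rewrite mulr_ge0// (le_trans _ K1).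
split; [exact: measurable_box|exact: measurable_box| | |].
- by rewrite leb3_box// lee_fin le_eqVlt; apply/orP; left; apply/eqP; ring.
- by rewrite leb3_box// lee_fin; have := exprn_ge0 3 d0; lra.
move=> x /boxP[]; rewrite !subr0 => x1 x2 x3.
exists (t0, s0) => //; exists (rect 0 1 0 1); split.
- exact: measurable_rect.
- by apply: rect_sub_angles => //; have := pi_ge2 R; lra.
- by rewrite leb2_rect// lee_fin; lra.
move=> z _; apply/boxP; rewrite /= !subr0.
have rad := radius_le z.1 t0r s0r.
have a1 := le_trans (norm_mul_cos_le (t0 + s0 * cos z.1) z.2) rad.
have a2 := le_trans (norm_mul_sin_le (t0 + s0 * cos z.1) z.2) rad.
have a3 := norm_mul_sin_le s0 z.1; rewrite (gtr0_norm s0_gt0) in a3.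
by split; rewrite (le_trans (ler_normB _ _))//; lra.
Qed.

(** The exponents (1, 3, 0) give u <= 3v. The patch of the reflected torus with angles in [0, 1]^2
    is covered by (n + 2)^2 boxes of side about e centred at grid points, of total measure about
    e^-2 e^3. *)
Lemma test_sets_torus_neighbourhood n : let e := n.+1%:R^-1 : R in
  test_sets J (32 * K ^+ 3 * e `^ 1) (1 * e `^ 3) (1 * e `^ 0).
Proof.
move=> e; have e0 : 0 < e by rewrite invr_gt0.
have [s0_gt0 t0_gt0 tsL J0] := ball_bounds t0r s0r.
rewrite powRr0 powRr1 ?(ltW e0)// powR_mulrn ?(ltW e0)//.
have Ke0 : 0 <= K * e by rewrite mulr_ge0 ?(ltW e0)// (le_trans _ K1).
pose B (i : nat * nat) := box (- torus_param (t0, s0) (i.1%:R * e, i.2%:R * e))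
  (K * e) (K * e) (K * e).
pose I := [seq (i, j) | i <- iota 0 n.+2, j <- iota 0 n.+2].
have mB i : measurable (B i) by exact: measurable_box.
exists (\big[setU/set0]_(i <- I) B i), (box 0 e e e).
split.
- exact: bigsetU_measurable.
- exact: measurable_box.
- apply: (le_trans (measure_bigsetU_le
    (m := 8 * (K * e * (K * e) * (K * e))) _ mB _)).
    by move=> i; rewrite /B leb3_box.
  rewrite lee_fin size_allpairs size_iota natrM.
  have -> : n.+2%:R = e^-1 + 1 :> R by rewrite invrK natr1.
  have e1 : e <= 1 by rewrite invf_le1// ler1n.
  have ee : e^-1 * e = 1 by rewrite mulVf// gt_eqF.
  (* Each grid direction contributes (n + 2) e = 1 + e <= 2, whence the factor 4 between 8 and
     32. *)
  rewrite [leLHS](_ : _ = 8 * K ^+ 3 * e * ((e^-1 * e + e) * (e^-1 * e + e)));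
    last by ring.
  rewrite ee (_ : 32 * K ^+ 3 * e = 8 * K ^+ 3 * e * 4); last by ring.
  apply: ler_wpM2l; last by have := mulr_ge0 (ltW e0) (ltW e0); nra.
  by rewrite !mulr_ge0 ?exprn_ge0 ?(ltW e0)// (le_trans _ K1).
- by rewrite leb3_box ?(ltW e0)// lee_fin; have := exprn_ge0 3 (ltW e0); lra.
move=> x /boxP[]; rewrite !subr0 => x1 x2 x3.
exists (t0, s0) => //; exists (rect 0 1 0 1); split.
- exact: measurable_rect.
- by apply: rect_sub_angles => //; have := pi_ge2 R; lra.
- by rewrite leb2_rect// lee_fin; lra.
move=> z [/= z1 z2]; rewrite !in_itv/= in z1 z2.
have [i iN zi] := grid_point n z1; have [j jN zj] := grid_point n z2.
rewrite -bigcup_seq; exists (i, j).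
  by apply/allpairsP; exists (i, j); rewrite !mem_iota.
rewrite -/e in zi zj.
apply/boxP => /=; move: (i%:R * e) (j%:R * e) zi zj => a b za zb.
have rad := radius_le z.1 t0r s0r.
have ca := le_trans (cos_lipschitz z.1 a) za.
have sa := le_trans (sin_lipschitz z.1 a) za.
have cb := le_trans (cos_lipschitz z.2 b) zb.
have sb := le_trans (sin_lipschitz z.2 b) zb.
have s0s0 : `|s0| <= s0 by rewrite gtr0_norm.
have p1 := norm_mul_le rad cb.
have p2 := norm_mul_le rad sb.
have p3 := norm_mul_le s0s0 ca.
have p4 := norm_mul_le s0s0 sa.
have p5 := le_trans (norm_mul_cos_le _ b) p3.
have p6 := le_trans (norm_mul_sin_le _ b) p3.
have := ler_wpM2r (ltW e0) tsL.
have := mulr_ge0 (ltW t0_gt0) (ltW e0).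
have := mulr_ge0 (ltW s0_gt0) (ltW e0).
move: x1 x2 x3 p1 p2 p4 p5 p6; rewrite !ler_norml /K.
move=> /andP[? ?] /andP[? ?] /andP[? ?] /andP[? ?] /andP[? ?] /andP[? ?].
move=> /andP[? ?] /andP[? ?] ? ? ?.
by split; apply/andP; split; lra.
Qed.

(** The exponents (3, 2, 1) give 3u <= 1 + 2v. The choice s = x_3 cancels the height of x, so one
    neighbourhood of a circle in the plane x_3 = 0, covered by n + 2 boxes, serves the whole tube
    [E]. *)
Lemma test_sets_circle_neighbourhood n : let e := n.+1%:R^-1 : R in
  test_sets J (16 * K ^+ 3 * e `^ 3) (r * e `^ 2) (r * e `^ 1).
Proof.
move=> e; have e0 : 0 < e by rewrite invr_gt0.
have e1 : e <= 1 by rewrite invf_le1// ler1n.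
rewrite powRr1 ?(ltW e0)// !powR_mulrn ?(ltW e0)//.
have Ke0 : 0 <= K * e by rewrite mulr_ge0 ?(ltW e0)// (le_trans _ K1).
have Kee0 : 0 <= K * e ^+ 2.
  by rewrite mulr_ge0 ?exprn_ge0 ?(ltW e0)// (le_trans _ K1).
pose B i := box (- (t0 * cos (i%:R * e)), - (t0 * sin (i%:R * e)), 0)
  (K * e) (K * e) (K * e ^+ 2).
have mB i : measurable (B i) by exact: measurable_box.
exists (\big[setU/set0]_(i <- iota 0 n.+2) B i), (box (0, 0, s0) e e r).
split.
- exact: bigsetU_measurable.
- exact: measurable_box.
- apply: (le_trans (measure_bigsetU_le
    (m := 8 * (K * e * (K * e) * (K * e ^+ 2))) _ mB _)).
    by move=> i; rewrite /B leb3_box.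
  rewrite lee_fin size_iota.
  have -> : n.+2%:R = e^-1 + 1 :> R by rewrite invrK natr1.
  have ee : e^-1 * e = 1 by rewrite mulVf// gt_eqF.
  rewrite [leLHS](_ : _ = 8 * K ^+ 3 * e ^+ 3 * (e^-1 * e + e)); last by ring.
  rewrite ee (_ : 16 * K ^+ 3 * e ^+ 3 = 8 * K ^+ 3 * e ^+ 3 * 2); last by ring.
  apply: ler_wpM2l; last by lra.
  by rewrite !mulr_ge0 ?exprn_ge0 ?(ltW e0)// (le_trans _ K1).
- rewrite leb3_box ?(ltW e0) ?(ltW r0)// lee_fin.
  by have := mulr_ge0 (ltW r0) (exprn_ge0 2 (ltW e0)); lra.
move=> x /boxP[/=]; rewrite !subr0 => x1 x2 x3.
have [s_gt0 t_gt0 tsL Jx] := ball_bounds t0r x3.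
exists (t0, x.2) => //; exists (rect (pi / 2) (pi / 2 + e) 0 1); split.
- exact: measurable_rect.
- by apply: rect_sub_angles => //; have := pi_ge2 R; lra.
- rewrite leb2_rect; [|by lra|by []].
  by rewrite lee_fin; have := ler_wpM2r (ltW e0) r1; lra.
move=> z [/= z1 z2]; rewrite !in_itv/= in z1 z2.
have [i iN zi] := grid_point n z2; rewrite -/e in zi.
have {}iN : i \in iota 0 n.+2 by rewrite mem_iota.
rewrite -bigcup_seq; exists i => //.
apply/boxP => /=; move: (i%:R * e) zi => b zb.
have [c1 c2] := polar_angle_bounds z1.
have cb := le_trans (cos_lipschitz z.2 b) zb.
have sb := le_trans (sin_lipschitz z.2 b) zb.
have t0t0 : `|t0| <= t0 by rewrite gtr0_norm.
have xx : `|x.2| <= x.2 by rewrite gtr0_norm.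
have p1 := norm_mul_le t0t0 cb.
have p2 := norm_mul_le t0t0 sb.
have p3 := norm_mul_le xx c1.
have p4 := norm_mul_le xx c2.
have p5 := le_trans (norm_mul_cos_le _ z.2) p3.
have p6 := le_trans (norm_mul_sin_le _ z.2) p3.
have := ler_wpM2r (ltW e0) tsL.
have := ler_wpM2r (exprn_ge0 2 (ltW e0)) tsL.
have := mulr_ge0 (ltW t_gt0) (ltW e0).
have := mulr_ge0 (ltW s_gt0) (ltW e0).
have := mulr_ge0 (ltW t_gt0) (exprn_ge0 2 (ltW e0)).
have := mulr_ge0 (ltW s_gt0) (exprn_ge0 2 (ltW e0)).
have := exprn_ge0 2 (ltW e0).
move: x1 x2 p1 p2 p4 p5 p6; rewrite !ler_norml /K.
move=> /andP[? ?] /andP[? ?] /andP[? ?] /andP[? ?] /andP[? ?].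
move=> /andP[? ?] /andP[? ?] ? ? ? ? ? ? ?.
by split; apply/andP; split; lra.
Qed.

(** At theta = pi/2, phi = 0 the parametrized point is (x_1, 0, x_3). The first error is x_1 (1 -
    cos phi) - x_3 cos theta cos phi, so phi of size e balances theta - pi/2 of size e^2. *)
Lemma polar_cap_bounds (x : borelR3 R) (e : R) (z : borelR2 R) :
  `|x.1.1 - t0| <= r -> `|x.2 - s0| <= r -> 0 <= e ->
  rect (pi / 2) (pi / 2 + e ^+ 2) 0 e z ->
  let y := torus_param (x.1.1, x.2) z in
  [/\ `|x.1.1 - y.1.1| <= K * e ^+ 2, `|y.1.2| <= L * e &
      `|x.2 - y.2| <= K * e ^+ 4].
Proof.
move=> x1 x3 e0 [/= z1 z2]; rewrite !in_itv/= in z1 z2.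
have [s_gt0 t_gt0 tsL _] := ball_bounds x1 x3.
have [c1 c2] := polar_angle_bounds z1; rewrite -exprM in c2.
have t0t0 : `|x.1.1| <= x.1.1 by rewrite gtr0_norm.
have xx : `|x.2| <= x.2 by rewrite gtr0_norm.
have ze : `|z.2| <= e by case/andP: z2 => ? ?; rewrite ger0_norm.
have cz : `|1 - cos z.2| <= e ^+ 2.
  apply: (le_trans (one_sub_cos_le _)).
  by rewrite -[leLHS]real_normK ?num_real// lerXn2r// nnegrE.
have p1 := norm_mul_le t0t0 cz.
have p2 := norm_mul_le xx c1.
have p3 := le_trans (norm_mul_cos_le _ z.2) p2.
have p4 := norm_mul_le (radius_le z.1 x1 x3) (le_trans (norm_sin_le z.2) ze).
have p5 := norm_mul_le xx c2.
have q1 := ler_wpM2r e0 tsL.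
have q2 := ler_wpM2r (exprn_ge0 2 e0) tsL.
have q3 := ler_wpM2r (exprn_ge0 4 e0) tsL.
have q4 := mulr_ge0 (ltW t_gt0) (exprn_ge0 2 e0).
have q5 := mulr_ge0 (ltW s_gt0) (exprn_ge0 2 e0).
have q6 := mulr_ge0 (ltW t_gt0) (exprn_ge0 4 e0).
have q7 := mulr_ge0 (ltW s_gt0) (exprn_ge0 4 e0).
have q8 := exprn_ge0 2 e0; have q9 := exprn_ge0 4 e0.
rewrite /=; split; last 2 first.
- exact: le_trans p4 q1.
- rewrite (_ : x.2 - x.2 * sin z.1 = x.2 * (1 - sin z.1)); last by ring.
  by apply: (le_trans p5); rewrite /K; lra.
move: p1 p3; rewrite !ler_norml /K => /andP[? ?] /andP[? ?].
by apply/andP; split; lra.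
Qed.

(** The exponents (7, 1, 3) give 7u <= 3 + v. Both parameters are spent on cancelling x_1 and x_3,
    so [E] has to be thin only in the second coordinate. *)
Lemma test_sets_polar_cap n : let e := n.+1%:R^-1 : R in
  test_sets J (8 * K ^+ 3 * e `^ 7) (r ^+ 2 * e `^ 1) (r ^+ 2 * e `^ 3).
Proof.
move=> e; have e0 : 0 < e by rewrite invr_gt0.
have e1 : e <= 1 by rewrite invf_le1// ler1n.
have K0 : 0 <= K by exact: le_trans K1.
have e20 : 0 <= e ^+ 2 by rewrite exprn_ge0 ?ltW.
have e40 : 0 <= e ^+ 4 by rewrite exprn_ge0 ?ltW.
rewrite powRr1 ?(ltW e0)// !powR_mulrn ?(ltW e0)//.
exists (box 0 (K * e ^+ 2) (K * e) (K * e ^+ 4)), (box (t0, 0, s0) r e r).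
split; [exact: measurable_box|exact: measurable_box| | |].
- rewrite leb3_box ?mulr_ge0 ?(ltW e0)// lee_fin.
  by rewrite le_eqVlt; apply/orP; left; apply/eqP; ring.
- rewrite leb3_box ?(ltW e0) ?(ltW r0)// lee_fin.
  by have := mulr_ge0 (exprn_ge0 2 (ltW r0)) (ltW e0); lra.
move=> x /boxP[/=]; rewrite !subr0 => x1 x2 x3.
have [_ _ _ Jx] := ball_bounds x1 x3.
exists (x.1.1, x.2) => //.
exists (rect (pi / 2) (pi / 2 + e ^+ 2) 0 e); split.
- exact: measurable_rect.
- have := pi_ge2 R; have : e ^+ 2 <= 1 by rewrite exprn_ile1 ?(ltW e0).
  by move=> ? ?; apply: rect_sub_angles; lra.
- rewrite leb2_rect ?(ltW e0)//; last by lra.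
  rewrite lee_fin (_ : _ * (e - 0) = e ^+ 3); last by ring.
  by rewrite ler_piMl ?exprn_ge0 ?exprn_ile1 ?(ltW e0) ?(ltW r0).
move=> z /(polar_cap_bounds x1 x3 (ltW e0)) /= [b1 b2 b3].
apply/boxP; rewrite /= !subr0; split => //.
rewrite (le_trans (ler_normB _ _))// /K.
by have := mulr_ge0 (ltW L0) (ltW e0); lra.
Qed.

(** * Superposition of dyadic scales at p = q = 2 *)

Let e (j : nat) : R := 2^-1 ^+ j.

Let e_gt0 j : 0 < e j. Proof. by rewrite exprn_gt0// invr_gt0. Qed.

Let e_le1 j : e j <= 1.
Proof. by rewrite exprn_ile1// ?invr_ge0// invf_le1//; lra. Qed.

(** The second side is [K], not [K * e j], so that x_2 may range over [-1, 1] at every scale; the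
    measure is then of order e^6 = 64^-j. *)
Let B j : set (borelR3 R) := box 0 (K * e j ^+ 2) K (K * e j ^+ 4).

Let D j : set (borelR2 R) :=
  rect (pi / 2) (pi / 2 + e j ^+ 2) (3 / 4 * e j) (e j).

(* [Num.sqrt \o g n] is at least [8 ^+ j] on [B j], and the [D j], of measure
   [8 ^- j / 4], are disjoint: each scale adds 1/4 to the average. *)
Let g n (x : borelR3 R) : R := \sum_(j < n) 64 ^+ j * \1_(B j) x.

Let g_ge0 n x : 0 <= g n x.
Proof. by apply: sumr_ge0 => j _; rewrite mulr_ge0. Qed.

Let mB j : measurable (B j). Proof. exact: measurable_box. Qed.

Let leb3_B j : leb3 (B j) = (8 * K ^+ 3 / 64 ^+ j)%:E.
Proof.
have K0 : 0 <= K by exact: le_trans K1.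
rewrite leb3_box ?mulr_ge0 ?exprn_ge0 ?(ltW (e_gt0 _))//; congr EFin.
rewrite [LHS](_ : _ = 8 * K ^+ 3 * e j ^+ 6); last by ring.
have E : 2^-1 ^+ 6 = 64^-1 :> R by field.
by rewrite /e -exprM mulnC exprM E exprVn.
Qed.

Let integral_g n : (\int[leb3]_x (g n x)%:E = (8 * K ^+ 3 * n%:R)%:E)%E.
Proof.
under eq_integral do rewrite /g -sumEFin.
rewrite ge0_integral_sum//; last first.
  by move=> j; apply/measurable_EFinP; exact: measurable_funM.
rewrite (eq_bigr (fun=> (8 * K ^+ 3)%:E)) => [|j _].
  by rewrite sumEFin sumr_const card_ord mulr_natr.
under eq_integral do rewrite EFinM.
rewrite ge0_integralZl//; last exact/measurable_EFinP.
rewrite integral_indic// setIT leb3_B -EFinM; congr EFin.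
by rewrite mulrCA divff ?mulr1// expf_neq0.
Qed.

Let D_disjoint : trivIset setT D.
Proof.
apply/trivIsetP => i j _ _; wlog ij : i j / (i < j)%N.
  move=> H; rewrite neq_ltn => /orP[h|h].
    by apply: H => //; rewrite ltn_eqF.
  by rewrite setIC; apply: H => //; rewrite ltn_eqF.
move=> _; rewrite -subset0 => z [[_ /= zi] [_ /= zj]].
rewrite !in_itv/= in zi zj; move: zi zj => /andP[zi _] /andP[_ zj].
(* Later scales satisfy phi <= e_i / 2, below the lower end 3/4 e_i of the range of phi in [D i]. *)
have : e j <= e i / 2.
  rewrite /e -exprSr ler_wiXn2l// ?invr_ge0// invf_le1//; lra.
have := e_gt0 i; lra.
Qed.

Let average_ge n (x : borelR3 R) : box (t0, 0, s0) r 1 r x ->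
  ((n%:R / 4)%:E <= torus_average (x.1.1, x.2) (Num.sqrt \o g n) x)%E.
Proof.
move=> /boxP[/=]; rewrite subr0 => x1 x2 x3.
have <- : (\sum_(i < n) ((8 ^+ i)%:E * leb2 (D i)) = (n%:R / 4 : R)%:E)%E.
  rewrite (eq_bigr (fun=> (4^-1)%:E)) => [|j _].
    by rewrite sumEFin sumr_const card_ord mulr_natl.
  have := e_gt0 j; have := exprn_gt0 2 (e_gt0 j) => *.
  rewrite leb2_rect; [|lra|lra]; rewrite -EFinM; congr EFin.
  have E8 : 8 ^+ j * e j ^+ 3 = 1.
    have h : 8 * 2^-1 ^+ 3 = 1 :> R by field.
    by rewrite /e -exprM mulnC exprM -exprMn h expr1n.
  transitivity (8 ^+ j * e j ^+ 3 / 4); last by rewrite E8 mul1r.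
  by move: (e j) (8 ^+ j) => a b; field.
pose Dn j := if (j < n)%N then D j else set0.
rewrite (eq_bigr (fun i : 'I_n => (8 ^+ i)%:E * leb2 (Dn i))%E); last first.
  by move=> i _; rewrite /Dn ltn_ord.
apply: (@torus_average_ge _ _ _ _ n Dn (fun j => 8 ^+ j)).
- by move=> y; exact: sqrtr_ge0.
- by move=> j; exact: exprn_ge0.
- by move=> j; rewrite /Dn; case: ifP => // _; exact: measurable_rect.
- move=> j; rewrite /Dn; case: ifP => // _.
  have := e_gt0 j; have := pi_ge2 R; have : e j ^+ 2 <= 1.
    by rewrite exprn_ile1 ?(ltW (e_gt0 _)).
  by have := e_le1 j => *; apply: rect_sub_angles; lra.
- move=> i j _ _; rewrite /Dn; case: ifP => _; case: ifP => _;
    rewrite ?setI0 ?set0I.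
  + exact: D_disjoint.
  + by move=> [].
  + by move=> [].
  + by move=> [].
move=> j z; rewrite /Dn; case: ifP => // jn [z1 z2].
have Bj : B j (x - torus_param (x.1.1, x.2) z).
  have zr : rect (pi / 2) (pi / 2 + e j ^+ 2) 0 (e j) z.
    split => //; move: z2; rewrite /= !in_itv/= => /andP[? ->].
    by rewrite andbT; have := e_gt0 j; lra.
  have [/= b1 b2 b3] := polar_cap_bounds x1 x3 (ltW (e_gt0 j)) zr.
  apply/boxP; rewrite /= !subr0; split => //.
  rewrite (le_trans (ler_normB _ _))//.
  have := ler_wpM2l (ltW L0) (e_le1 j); rewrite /K.
  by move: b2; rewrite -/L; have := L0; lra.
(* Only the [j]-th term of [g n] is kept: the root of 64^j is 8^j. *)
have -> : 8 ^+ j = Num.sqrt ((8 ^+ j) ^+ 2) :> R.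
  by rewrite sqrtr_sqr ger0_norm.
rewrite ler_sqrt// /g (bigD1 (Ordinal jn))//= indicE mem_set// mulr1.
rewrite -exprM mulnC exprM (_ : 8 ^+ 2 = 64 :> R); last by ring.
by rewrite lerDl sumr_ge0// => i _; rewrite mulr_ge0.
Qed.

(** With N = n + 1 and a the root of the measure of the fixed box [E], the estimate reads N/4 a <= C
    (8 K^3 N)^(1/2); dividing by N^(1/2) would bound N^(1/2). *)
Lemma torus_maximal_estimate22_fails : ~ torus_maximal_estimate J 2%:E 2%:E.
Proof.
move=> [C HC].
have K0 : 0 <= K by exact: le_trans K1.
have mE : measurable (box (t0, 0, s0) r 1 r) by exact: measurable_box.
set a := (8 * (r * 1 * r)) `^ 2^-1.
have a0 : 0 < a by rewrite powR_gt0// !mulr_gt0.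
apply: (@powR_unbounded R 2^-1 (C * (8 * K ^+ 3) `^ 2^-1 / a * 4)) => [|n].
  by rewrite invr_gt0.
have Nf : ('N[leb3]_2%:E[EFin \o (Num.sqrt \o g n.+1)] =
    ((8 * K ^+ 3 * n.+1%:R) `^ 2^-1)%:E)%E.
  by rewrite Lnorm2_sqrt// integral_g poweR_EFin.
have : Num.sqrt \o g n.+1 \in Lfun leb3 2%:E.
  rewrite inE/=; apply/andP; split; rewrite inE/=; last first.
    by rewrite /finite_norm Nf ltry.
  apply: measurableT_comp.
    by apply: continuous_measurable_fun; exact: sqrt_continuous.
  by apply: measurable_sum => j; exact: measurable_funM.
move=> /HC; rewrite Nf -EFinM.
have m0 : 0 < 8 * (r * 1 * r) by rewrite !mulr_gt0.
have mEm : ((8 * (r * 1 * r))%:E <= leb3 (box (t0, 0%R, s0) r 1 r))%E.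
  by rewrite leb3_box ?(ltW r0).
have c0 : 0 <= n.+1%:R / 4 :> R by [].
have cf x : box (t0, 0, s0) r 1 r x ->
    ((n.+1%:R / 4)%:E <= `|torus_maximal J (Num.sqrt \o g n.+1) x|)%E.
  move=> Ex; have /boxP[x1 _ x3] := Ex.
  have [_ _ _ Jx] := ball_bounds x1 x3.
  exact: torus_maximal_ge Jx (average_ge _ Ex).
have two1 : (1 <= 2%:E :> \bar R)%E by rewrite lee_fin; lra.
move=> /(le_trans (Lnorm_ge_cst two1 mE mEm m0 c0 cf)); rewrite lee_fin.
rewrite (inver 2) pnatr_eq0/= -/a powRM ?mulr_ge0 ?exprn_ge0// => H.
have N0 : 0 < n.+1%:R `^ 2^-1 :> R by exact: powR_gt0.
have NN : n.+1%:R = n.+1%:R `^ 2^-1 * n.+1%:R `^ 2^-1 :> R.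
  by rewrite -expr2 -powR_mulrn// -powRrM mulVf// powRr1.
rewrite [in X in X <= _]NN in H; move: (n.+1%:R `^ 2^-1) N0 H => y y0 H.
rewrite -(ler_pM2r y0) -(ler_pM2r a0).
rewrite (_ : y * y * a = y * y / 4 * a * 4); last by field.
rewrite [leRHS](_ : _ = C * ((8 * K ^+ 3) `^ 2^-1 * y) * 4).
  by rewrite ler_pM2r.
by field; rewrite gt_eqF.
Qed.

End test_families.

(** * The quadrangle as an intersection of half-planes, and the conclusion *)

(** The diagonal 2u = 5v through (0, 0) and P_1 cuts the quadrangle into two triangles. The weights
    are the barycentric coordinates in each, affine forms vanishing on the opposite side. *)
Lemma closed_quadrangle_of_ineqs (R : realType) (u v : R) :
  v <= u -> u <= 3 * v -> 3 * u <= 1 + 2 * v -> 7 * u <= 3 + v ->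
  closed_quadrangle (u, v).
Proof.
move=> h1 h2 h3 h4.
have conv (a b c d : R) : 0 <= a -> 0 <= b -> 0 <= c -> 0 <= d ->
    a + b + c + d = 1 -> u = b / 2 + 5 / 11 * c + 3 / 7 * d ->
    v = b / 2 + 2 / 11 * c + d / 7 -> closed_quadrangle (u, v).
  move=> a0 b0 c0 d0 s1 -> ->.
  exists (fun i : 'I_4 => [:: a; b; c; d]`_i); split.
  - by case=> [[|[|[|[|]]]]].
  - by rewrite !big_ord_recl big_ord0/= -s1; ring.
  - rewrite !big_ord_recl big_ord0 /quadrangle_vertex /=.
    by apply/pair_equal_spec; rewrite /= /GRing.scale /=; split; field.
case: (leP (2 * u) (5 * v)) => h.
- apply: (conv (1 - (7 * u - v) / 3) (2 / 3 * (5 * v - 2 * u))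
    (11 / 3 * (u - v)) 0); lra.
- apply: (conv (1 - (3 * u - 2 * v)) 0 (11 * (3 * v - u))
    (7 * (2 * u - 5 * v))); lra.
Qed.

Lemma interior_ball (R : realType) (J : set (R * R)) : J° !=set0 ->
  exists t0 s0 r : R, [/\ 0 < r, r <= 1 &
    forall t s, `|t - t0| <= r -> `|s - s0| <= r -> J (t, s)].
Proof.
move=> [[t0 s0] /nbhs_ballP[d /= d0 dJ]].
(* Halving [d] fits the closed square into the open ball. *)
exists t0, s0, (Num.min (d / 2) 1); split.
- by rewrite lt_min ltr01 andbT; exact: divr_gt0.
- by rewrite ge_min lexx orbT.
move=> t s; rewrite !le_min => /andP[t1 _] /andP[s1 _]; apply: dJ.
split; by rewrite /= -ball_normE /= distrC; lra.
Qed.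

(* [fine p^-1] is 1/p, with the convention 1/oo = 0. *)
Theorem mainTheorem3 (R : realType) (J : set (R * R)) (p q : \bar R)
    (Jcompact : compact J) (Jsub : J `<=` admissible)
    (Jint : J° !=set0)
    (p1 : (1 <= p)%E) (q1 : (1 <= q)%E)
    (pq : ~ (closed_quadrangle `\ (1/2, 1/2)) (fine p^-1%E, fine q^-1%E)) :
  ~ torus_maximal_estimate J p q.
Proof.
move=> est; have [t0 [s0 [r [r0 r1 Jr]]]] := interior_ball Jint.
have Jball t s : `|t - t0| <= r -> `|s - s0| <= r -> 0 < s < t /\ J (t, s).
  by move=> tr sr; have Jts := Jr _ _ tr sr; split => //; exact: (Jsub (t, s)).
have t0r : `|t0 - t0| <= r by rewrite subrr normr0 ltW.
have s0r : `|s0 - s0| <= r by rewrite subrr normr0 ltW.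
have [? ? ? _] := ball_bounds Jball t0r s0r.
set K := 1 + 2 * (t0 + s0 + 2 * r).
have K0 : 0 < K by rewrite /K; lra.
have KK (c : R) : 0 < c -> 0 < c * K ^+ 3.
  by move=> c0; rewrite mulr_gt0// exprn_gt0.
have lt01R : 0 < 1 :> R by [].
have r20 : 0 < r ^+ 2 by rewrite exprn_gt0.
have Ha := test_sets_exponents p1 q1 est (KK 8 _) lt01R
  (test_sets_big_boxes r0 Jball).
have Hb := test_sets_exponents p1 q1 est (KK 32 _) lt01R
  (test_sets_torus_neighbourhood r0 Jball).
have Hc := test_sets_exponents p1 q1 est (KK 16 _) r0
  (test_sets_circle_neighbourhood r0 r1 Jball).
have Hd := test_sets_exponents p1 q1 est (KK 8 _) r20
  (test_sets_polar_cap r0 r1 Jball).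
(* The four inequalities put the exponents in the closed quadrangle; what remains is the vertex
   (1/2, 1/2), that is p = q = 2. *)
apply: pq; split.
  by apply: closed_quadrangle_of_ineqs; lra.
move=> [u v].
have inv2 (x : \bar R) : (1 <= x)%E -> fine x^-1%E = 1 / 2 -> x = 2%:E.
  case: x => [x||]//=.
  - rewrite lee_fin => x1; rewrite (inver x) gt_eqF/=; last by lra.
    by move=> xe; rewrite -[x]invrK xe div1r invrK.
  - by move=> _ /eqP; rewrite eq_sym div1r invr_eq0 pnatr_eq0.
rewrite (inv2 _ p1 u) (inv2 _ q1 v) in est.
exact: torus_maximal_estimate22_fails Jball est.
Qed.
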